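(* Let $\Xi=[a,b]\subset\mathbb R$ with $a<b$, and assume that the probability measure $\mu$ on $\Xi$ has continuous density $g_\mu$ with respect to Lebesgue measure. Let $h_N(\theta)=N^{-1}\log(m_N(\theta))$. Assume moreover that 1. the sequence $h_N$ converges uniformly to a function $h\in C^1([a,b])$; 2. the function $h$ satisfies $\arg\max_{\theta\in\Xi}h(\theta)\cap\mathrm{supp}(\mu)=\{\theta_1^*,\theta_2^*\}=\{a,b\}$ with $h(a)=h(b)>0$, $h'(a)<0$ and $h'(b)>0$ (where $h'(a)$ denotes the right derivative at $a$ and $h'(b)$ the left derivative at $b$); 3. for each $i\in\{1,2\}$, $$N\big(h_N(\theta_i^* )-h(\theta_i^* )\big)\to d_i \quad\text{with } |d_i|<\infty,$$ and $$\sup_{\theta\in[\theta_i^*-\delta,\theta_i^*+\delta]\cap[a,b]}|h_N'(\theta)-h'(\theta)|\to0 \quad\text{as } N\to\infty,$$ for all $\delta>0$ sufficiently small. Then there is emerging dominance at $\{\theta_1^*,\theta_2^*\}$ with weights $\{w_1,w_2\}$ given by $$w_i=\frac{(-1)^i e^{d_i}g_\mu(\theta_i^* )/h'(\theta_i^* )}{e^{d_2}g_\mu(\theta_2^* )/h'(\theta_2^* )-e^{d_1}g_\mu(\theta_1^* )/h'(\theta_1^* )},\qquad i=1,2.$$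
   Context: Setting. $\Xi$ is a compact metric space (here $[a,b]$) and $\mu$ a probability measure on $\Xi$ with support $\mathrm{supp}(\mu)$. $(\mathcal X_N)_{N\ge1}$ is an increasing sequence of finite sets, $x_0\in\mathcal X_1$, $T_N\subset\mathcal X_N$ with $x_0\notin T_N$, and for each $N\ge1$, $(Q_N^{(\theta)})_{\theta\in\Xi}$ is a family of irreducible stochastic matrices on $\mathcal X_N$. (These data define, for each $N$, a Self-Switching Markov Chain: a state $\theta$ is drawn from $\mu$, a location process moves from $x_0$ according to $Q_N^{(\theta)}$ until it hits $T_N$, after which it restarts from $x_0$ with a fresh independent state drawn from $\mu$.) For $\theta\in\Xi$, $m_N(\theta)$ denotes the expected first time that the Markov chain on $\mathcal X_N$ started at $x_0$ with transition matrix $Q_N^{(\theta)}$ hits $T_N$. Standing assumption: for each $N$, the function $m_N:\Xi\to\mathbb R$ is continuous. For Borel $A\subseteq\Xi$ set $\widehat P_N(A):=\dfrac{\int_A m_N\,d\mu}{\int_\Xi m_N\,d\mu}$, a probability measure on $\Xi$. Emerging dominance: given $\{\theta_1^*,\dots,\theta_K^*\}\subsetneq\mathrm{supp}(\mu)$ (proper inclusion), there is emerging dominance at $\{\theta_1^*,\dots,\theta_K^*\}$ with positive weights $\{w_1,\dots,w_K\}$ if $\widehat P_N$ converges weakly, as $N\to\infty$, to $\sum_{i=1}^K w_i\delta_{\theta_i^*}$, and $\sum_{i=1}^K w_i=1$.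
   Formalization: The density is additionally assumed positive at both endpoints, g_μ(a)>0 and g_μ(b)>0; otherwise a weight is zero (e.g. g_μ(t)=2t on [0,1]), contradicting the required positive weights, or the formula for the weights is 0/0. *)

(* Defs.v *)
From mathcomp Require Export all_boot all_order all_algebra finmap.
From mathcomp Require Export all_classical all_reals all_analysis.

Set Implicit Arguments.
Unset Strict Implicit.
Unset Printing Implicit Defensive.

Import Order.TTheory GRing.Theory Num.Theory.
Import numFieldNormedType.Exports.

Local Open Scope classical_set_scope.
Local Open Scope ring_scope.

Definition stochastic (R : realType) (I : finType) (Q : I -> I -> R) : Prop :=
  (forall x y, 0 <= Q x y) /\ (forall x, \sum_(y : I) Q x y = 1).

Fixpoint transition_power (R : realType) (I : finType) (Q : I -> I -> R)
    (n : nat) (x y : I) : R :=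
  if n is k.+1 then \sum_(z : I) Q x z * transition_power Q k z y
  else (x == y)%:R.

Definition irreducible (R : realType) (I : finType) (Q : I -> I -> R) : Prop :=
  forall x y, exists n, 0 < transition_power Q n x y.

(* The Markov property is stated in multiplied form, so that trajectories of
   probability zero need no separate treatment. *)
Definition markov_chain (R : realType) (I : finType) (d : measure_display)
    (Om : measurableType d) (P : probability Om R) (Q : I -> I -> R)
    (Z : nat -> Om -> I) : Prop :=
  (forall n x, measurable (Z n @^-1` [set x])) /\
  (forall n (p : nat -> I),
     P [set om | forall k, (k <= n.+1)%N -> Z k om = p k] =
     (P [set om | forall k, (k <= n)%N -> Z k om = p k]
        * (Q (p n) (p n.+1))%:E)%E).

(* Equal to +oo on the trajectories that never meet T. *)
Definition hitting_time (R : realType) (I : Type) (Om : Type)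
    (T : I -> Prop) (Z : nat -> Om -> I) (om : Om) : \bar R :=
  ereal_inf [set n%:R%:E | n in [set n | T (Z n om)]].

(* The expectation depends only on the law of the chain, hence only on Q, x0
   and T: all realizations of the chain give the same value v. *)
Definition is_mean_hitting_time (R : realType) (U : choiceType)
    (S : {fset U}) (Q : S -> S -> R) (x0 : U) (T : {fset U}) (v : R) : Prop :=
  exists (d : measure_display) (Om : measurableType d) (P : probability Om R)
    (Z : nat -> Om -> S),
  [/\ markov_chain P Q Z,
      P [set om | val (Z 0%N om) = x0] = 1%E
    & (\int[P]_om hitting_time R (fun x : S => val x \in T) Z om)%E = v%:E].

(* A measure on Xi is represented by a measure on the real line giving full
   mass to Xi. *)
Definition msupport (R : realType) (Xi : set R)
    (mu : set (measurableTypeR R) -> \bar R) : set R :=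
  [set t | Xi t /\ forall V : set R, open V -> V t -> (0 < mu (V `&` Xi))%E].

Definition has_density (R : realType) (Xi : set R)
    (mu : set (measurableTypeR R) -> \bar R) (g : R -> R) : Prop :=
  (forall t, Xi t -> 0 <= g t) /\
  (forall A : set (measurableTypeR R), measurable A -> A `<=` Xi ->
     mu A = (\int[lebesgue_measure]_(t in A) (g t)%:E)%E).

Definition weighted_law (R : realType) (Xi : set R)
    (mu : set (measurableTypeR R) -> \bar R) (m : R -> R) :
    set (measurableTypeR R) -> \bar R :=
  fun A => ((\int[mu]_(t in A `&` Xi) (m t)%:E)
              / (\int[mu]_(t in Xi) (m t)%:E))%E.

Definition dirac_mixture (R : realType) (K : nat) (w theta : 'I_K -> R) :
    set (measurableTypeR R) -> \bar R :=
  fun A => (\sum_(i < K) (w i)%:E * \d_(theta i) A)%E.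

(* The library's integral accepts any set function, so the laws need not be
   bundled with a proof that they are measures. The set Xi is meant to be
   compact: continuous test functions on it are bounded. *)
Definition weak_cvg (R : realType) (Xi : set R)
    (nu : nat -> set (measurableTypeR R) -> \bar R)
    (nu_lim : set (measurableTypeR R) -> \bar R) : Prop :=
  forall f : R -> R, {within Xi, continuous f} ->
    (\int[nu N]_(t in Xi) (f t)%:E)%E @[N --> \oo]
      --> (\int[nu_lim]_(t in Xi) (f t)%:E)%E.

Definition emerging_dominance (R : realType) (Xi : set R)
    (mu : set (measurableTypeR R) -> \bar R) (m : nat -> R -> R)
    (K : nat) (theta w : 'I_K -> R) : Prop :=
  [/\ injective theta,
      range theta `<` msupport Xi mu,
      forall i, 0 < w i,
      \sum_(i < K) w i = 1
    & weak_cvg Xi (fun N => weighted_law Xi mu (m N)) (dirac_mixture w theta)].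

(* Derivatives relative to a set Xi; on a segment they are the one-sided
   derivatives at the endpoints and the usual derivative in the interior. *)
Definition diff_quotient (R : realType) (f : R -> R) (x y : R) : R :=
  (f y - f x) / (y - x).

Definition derivable_in (R : realType) (Xi : set R) (f : R -> R) (x : R) :
    Prop :=
  cvg (diff_quotient f x y @[y --> within Xi x^']).

Definition derive_in (R : realType) (Xi : set R) (f : R -> R) (x : R) : R :=
  lim (diff_quotient f x y @[y --> within Xi x^']).

Definition C1_in (R : realType) (Xi : set R) (f : R -> R) : Prop :=
  (forall x, Xi x -> derivable_in Xi f x) /\
  {within Xi, continuous (derive_in Xi f)}.

Definition argmax_set (R : realType) (Xi : set R) (f : R -> R) : set R :=
  [set t | Xi t /\ forall s, Xi s -> f s <= f t].

Definition log_growth (R : realType) (m : nat -> R -> R) (N : nat) (t : R) : R :=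
  N%:R^-1 * ln (m N t).

(* Main.v *)
Require Import Defs.
From HB Require Import structures.
From mathcomp Require Import ring lra measurable_realfun.
Set Implicit Arguments.
Unset Strict Implicit.
Unset Printing Implicit Defensive.
Import Order.TTheory GRing.Theory Num.Theory.
Import numFieldNormedType.Exports.
Local Open Scope classical_set_scope.
Local Open Scope ring_scope.

(** Since [x0] lies outside [T N], the mean hitting time [m N t] is at least
1, hence [m N t = expR (N * h_N t)] with [h_N = log_growth m N], and the
weighted law has density proportional to [expR (N * (h_N t - h a)) * g t].
The theorem is then an instance of Laplace's method, with the two maxima at
the endpoints of the segment and both slopes nonzero there, so that each
endpoint contributes a mass of order 1/N.

Near an endpoint [e], the mean value theorem for [h_N] and the uniform
convergence of the derivatives give, for [t] close to [e] and [N] large,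
  [N * (h_N t - h e) = d + N * h'(e) * (t - e) + O (eps + N * eps * |t - e|)]
([scaled_increment_expansion]).  Away from the endpoints, [g] vanishes outside
the support of [mu], and on the part of the support that is at a fixed distance
from the endpoints, a compact set, [h] stays below its maximum by a constant;
uniform convergence transfers this gap to [h_N] ([scaled_increment_away]).
Consequently the integrand [phi t * expR (N * (h_N t - h a))] is trapped
between two sums of explicit exponential peaks centred at the endpoints, up to
an exponentially small error.  After multiplication by [N] the peaks have an
explicit integral in the limit, namely a function of [eps] that is continuous
at 0, and [laplace_endpoints] concludes that
  [N * \int phi t * expR (N * (h_N t - h a))]
tends to the sum over both endpoints of [phi e * expR d / |h'(e)|].
The quotient of these limits for [phi = f * g] and [phi = g] is the integral of
[f] against the claimed limit law.

The rest is measure theory.  The integral against a measure with a density is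
the integral of the product with the density ([ge0_integral_density]); it is
used twice, for the density of the weighted law with respect to [mu] and for
that of [mu] with respect to the Lebesgue measure.  As a continuous test
function is the difference of its positive and negative parts, nonnegative
test functions suffice ([weak_cvg_ge0]). *)

(** * Integration against a measure with a density *)

Section density.
Local Open Scope ereal_scope.
Import HBNNSimple.

(** Both sides agree on indicator functions by hypothesis, hence on simple
functions by additivity, and monotone convergence along an increasing
approximation of [f] by simple functions gives the general case. *)
Lemma ge0_integral_density d (T : measurableType d) (R : realType)
    (mu nu : {measure set T -> \bar R}) (D : set T) (k : T -> R)
    (f : T -> \bar R) :
  measurable D -> measurable_fun D k -> (forall x, D x -> (0 <= k x)%R) ->
  (forall A, measurable A -> A `<=` D ->
     nu A = \int[mu]_(x in A) (k x)%:E) ->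
  measurable_fun D f -> (forall x, D x -> 0 <= f x) ->
  \int[nu]_(x in D) f x = \int[mu]_(x in D) (f x * (k x)%:E).
Proof.
move=> mD mk k0 nuE mf f0; pose f_ := nnsfun_approx mD mf.
have fcvg x : D x -> (f_ n x)%:E @[n --> \oo] --> f x.
  by move=> Dx; apply: cvg_nnsfun_approx.
transitivity (limn (fun n => \int[nu]_(x in D) (f_ n x)%:E)).
  rewrite -monotone_convergence//=.
  - by apply: eq_integral => x /[!inE] Dx; apply/esym/cvg_lim => //; exact: fcvg.
  - by move=> n; exact/measurable_EFinP/measurable_funTS.
  - by move=> n x _; rewrite lee_fin.
  - by move=> x _ n p np; rewrite lee_fin//; exact/lefP/nd_nnsfun_approx.
transitivity (limn (fun n => \int[mu]_(x in D) ((f_ n x)%:E * (k x)%:E)));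
  last first.
  rewrite -monotone_convergence//=.
  - apply: eq_integral => x /[!inE] Dx; apply/cvg_lim => //.
    by apply: cvgeZr => //; exact: fcvg.
  - move=> n; apply: emeasurable_funM; last exact/measurable_EFinP.
    exact/measurable_EFinP/measurable_funTS.
  - by move=> n x Dx; rewrite mule_ge0 ?lee_fin ?k0.
  - move=> x Dx n p np; rewrite lee_wpmul2r ?lee_fin ?k0//.
    exact/lefP/nd_nnsfun_approx.
congr (limn _); apply/funext => n.
have mfr r : measurable (f_ n @^-1` [set r]) by [].
transitivity (\sum_(r \in range (f_ n))
    \int[nu]_(x in D) (r * \1_(f_ n @^-1` [set r]) x)%:E).
  under eq_integral do rewrite fimfunE -fsumEFin//.
  rewrite ge0_integral_fsum//.
  - by move=> y; exact/measurable_EFinP/measurable_funM.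
  - by move=> y x _; rewrite nnfun_muleindic_ge0.
transitivity (\sum_(r \in range (f_ n))
    \int[mu]_(x in D) ((r * \1_(f_ n @^-1` [set r]) x)%:E * (k x)%:E)).
  apply: eq_fsbigr => r /[!inE] -[y _ yr].
  have r0 : (0 <= r)%R by rewrite -yr.
  rewrite integralZl_indic_nnsfun// integral_indic// nuE//; last 1 first.
    exact: measurableI.
  under [RHS]eq_integral do rewrite EFinM -muleA.
  rewrite ge0_integralZl//.
  - congr (_ * _); rewrite setIC integral_mkcondr.
    by apply: eq_integral => x _; rewrite patchE indicE; case: ifPn => _; rewrite (mul1e, mul0e).
  - apply: emeasurable_funM; last exact/measurable_EFinP.
    exact/measurable_EFinP/measurable_funTS.
  - by move=> x Dx; rewrite mule_ge0 ?lee_fin ?k0.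
rewrite -ge0_integral_fsum//.
- apply: eq_integral => x /[!inE] Dx.
  rewrite [in RHS]fimfunE -fsumEFin// ge0_mule_fsuml// => y.
  exact: nnfun_muleindic_ge0.
- move=> r; apply: emeasurable_funM; last exact/measurable_EFinP.
  by apply/measurable_EFinP/measurable_funM => //; exact/measurable_funTS.
- by move=> r x Dx; rewrite mule_ge0 ?nnfun_muleindic_ge0 ?lee_fin ?k0.
Qed.

End density.

(** * Continuity and derivatives relative to a segment *)

Section within_tools.
Context {R : realType}.
Implicit Types (D : set R) (f g : R -> R) (a b x t e : R).

Lemma within_continuousP D f :
  {within D, continuous f} <->
  forall x, D x -> forall e, 0 < e -> exists2 delta : R, 0 < delta &
    forall t, D t -> `|t - x| <= delta -> `|f t - f x| <= e.
Proof.
rewrite subspace_continuousP; split=> cf x Dx.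
  move=> e e0; have /cvgrPdist_le /(_ e e0) := cf x Dx.
  rewrite near_withinE => /nbhs_ballP[r /= r0 rP].
  exists (r / 2); first by rewrite divr_gt0.
  move=> t Dt tx; rewrite distrC; apply: rP => //=.
  by rewrite /ball/= distrC (le_lt_trans tx)// ltr_pdivrMr// ltr_pMr// ltr1n.
apply/cvgrPdist_le => e e0; rewrite near_withinE.
have [r r0 rP] := cf x Dx e e0.
apply/nbhs_ballP; exists r => //= t; rewrite /ball/= => /ltW tr Dt.
by rewrite distrC; apply: rP; rewrite // distrC.
Qed.

Lemma within_continuousM D f g : {within D, continuous f} ->
  {within D, continuous g} -> {within D, continuous (fun t => f t * g t)}.
Proof. by move=> cf cg x; apply: cvgM; [exact: cf|exact: cg]. Qed.

Lemma within_continuousD D f g : {within D, continuous f} ->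
  {within D, continuous g} -> {within D, continuous (fun t => f t + g t)}.
Proof. by move=> cf cg x; apply: cvgD; [exact: cf|exact: cg]. Qed.

Lemma within_continuous_comp D f g : {within D, continuous f} ->
  (forall x, D x -> {for f x, continuous g}) ->
  {within D, continuous (fun t => g (f t))}.
Proof.
move=> /subspace_continuousP cf cg; apply/subspace_continuousP => x Dx.
by apply: (cvg_comp _ _ (cf x Dx)); exact: cg.
Qed.

Lemma within_continuous_bounded a b f : a < b ->
  {within `[a, b]%classic, continuous f} ->
  exists2 C : R, 0 < C & forall t, t \in `[a, b] -> `|f t| <= C.
Proof.
move=> ab cf.
have cn : {within `[a, b]%classic, continuous (fun t => `|f t|)}.
  by apply: within_continuous_comp cf _ => x _; exact: norm_continuous.
have [c _ cP] := EVT_max (ltW ab) cn.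
by exists (`|f c| + 1) => [|t /cP]; [rewrite ltr_wpDl|move/le_trans; apply; rewrite lerDl].
Qed.

Lemma derivable_in_continuous D f x : derivable_in D f x ->
  forall e, 0 < e -> exists2 delta : R, 0 < delta &
    forall t, D t -> `|t - x| <= delta -> `|f t - f x| <= e.
Proof.
move=> fx e e0; rewrite /derivable_in in fx.
pose l := derive_in D f x.
have /cvgrPdist_le /(_ 1 ltr01) : diff_quotient f x y @[y --> within D x^'] --> l by [].
rewrite near_withinE => /nbhs_ballP[r /= r0 rP].
pose C := `|l| + 1; have C0 : 0 < C by rewrite ltr_wpDl.
exists (Num.min (r / 2) (e / C)); first by rewrite lt_min !divr_gt0.
move=> t Dt; rewrite le_min => /andP[tr te].
have [->|tx] := eqVneq t x; first by rewrite subrr normr0 ltW.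
have : `|l - diff_quotient f x t| <= 1.
  apply: rP => //; rewrite /ball/= distrC (le_lt_trans tr)//.
  by rewrite ltr_pdivrMr// ltr_pMr// ltr1n.
have -> : f t - f x = diff_quotient f x t * (t - x).
  by rewrite /diff_quotient divfK// subr_eq0.
rewrite normrM => lq; have qC : `|diff_quotient f x t| <= C.
  rewrite -[X in `|X|](subKr l) (le_trans (ler_normB _ _))//.
  by rewrite lerD2l.
rewrite (le_trans (ler_pM _ _ qC te))//.
by rewrite mulrC divfK// gt_eqF.
Qed.

(** In the interior of the segment, restricting the difference quotient to the
segment does not change its limit, so the usual mean value theorem applies. *)
Lemma derivable_in_itv a b f x : x \in `]a, b[ ->
  derivable_in `[a, b]%classic f x ->
  is_derive x 1 f (derive_in `[a, b]%classic f x).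
Proof.
rewrite in_itv/= => /andP[ax xb] fx.
pose l := derive_in `[a, b]%classic f x.
suff fl : h^-1 *: ((f \o shift x) (h *: 1) - f x) @[h --> 0^'] --> (l : R).
  by apply: DeriveDef; [apply/cvg_ex; exists l|exact/cvg_lim].
have : diff_quotient f x y @[y --> within `[a, b]%classic x^'] --> l by [].
move=> /cvgrPdist_le fl; apply/cvgrPdist_le => e /fl.
rewrite near_withinE => /nbhs_ballP[r /= r0 rP].
pose s := Num.min r (Num.min (x - a) (b - x)).
have s0 : 0 < s by rewrite !lt_min r0 !subr_gt0 ax.
apply/nbhs_ballP; exists s => //= h.
rewrite /ball/= sub0r normrN !lt_min => /and3P[hr ha hb] h0.
have xh : h + x - x = h by rewrite addrK.
have := rP (h + x); rewrite /ball/= opprD addrCA subrr addr0 normrN => /(_ hr).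
rewrite /diff_quotient xh /= /GRing.scale/= mulr1 mulrC; apply.
  by rewrite -subr_eq0 xh.
by rewrite in_itv/=; move: ha hb; rewrite !ltr_norml => /andP[+ _] /andP[_ +]; lra.
Qed.

(** The symmetric form in [x] and [y], with the intermediate point [c] located by
its distance to [x], treats both endpoints of a segment alike. *)
Lemma MVT_in a b f x y :
  {within `[a, b]%classic, continuous f} ->
  x \in `[a, b] -> y \in `[a, b] ->
  (forall t, t \in `[a, b] -> `|t - x| <= `|y - x| ->
     derivable_in `[a, b]%classic f t) ->
  exists2 c, (c \in `[a, b]) && (`|c - x| <= `|y - x|) &
    f y - f x = derive_in `[a, b]%classic f c * (y - x).
Proof.
move=> cf xab yab df.
have mvt u v : u \in `[a, b] -> v \in `[a, b] -> u < v ->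
    (forall t, u < t < v -> `|t - x| <= `|y - x|) ->
    exists2 c, u < c < v & f v - f u = derive_in `[a, b]%classic f c * (v - u).
  rewrite !in_itv/= => /andP[au _] /andP[_ vb] uv uvP.
  have [||c cuv ->] := @MVT _ f (derive_in `[a, b]%classic f) u v uv.
  - move=> t; rewrite in_itv/= => /andP[ut tv].
    apply: derivable_in_itv; first by rewrite in_itv/= (le_lt_trans au)// (lt_le_trans tv).
    apply: df; last by apply: uvP; rewrite ut.
    by rewrite in_itv/= (le_trans au (ltW ut))/= (le_trans (ltW tv)).
  - apply: continuous_subspaceW cf => t/=; rewrite !in_itv/= => /andP[ut tv].
    by rewrite (le_trans au)//= (le_trans tv).
  - by exists c.
have sub c u v : u \in `[a, b] -> v \in `[a, b] -> u < c < v -> c \in `[a, b].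
  rewrite !in_itv/= => /andP[au _] /andP[_ vb] /andP[/ltW uc /ltW cv].
  by rewrite (le_trans au)//= (le_trans cv).
have [xy|yx|->] := ltgtP x y.
- have xyP t : x < t < y -> `|t - x| <= `|y - x|.
    by move=> /andP[? ?]; rewrite !ger0_norm; lra.
  have [c cxy fE] := mvt _ _ xab yab xy xyP.
  by exists c => //; rewrite (sub _ _ _ xab yab)//= xyP.
- have yxP t : y < t < x -> `|t - x| <= `|y - x|.
    by move=> /andP[? ?]; rewrite !ler0_norm; lra.
  have [c cxy fE] := mvt _ _ yab xab yx yxP.
  exists c; first by rewrite (sub _ _ _ yab xab)//= yxP.
  by rewrite -[LHS]opprB fE; ring.
- by exists y; rewrite ?yab ?subrr ?normr0 ?mulr0/=.
Qed.

End within_tools.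

(** * Integrals of exponentials *)

Section exponential_integrals.
Context {R : realType}.
Implicit Types (a b c p q t eta : R) (f g : R -> R).
Local Notation mu := (@lebesgue_measure R).

Lemma within_continuous_integrable a b f :
  {within `[a, b]%classic, continuous f} ->
  mu.-integrable `[a, b]%classic (EFin \o f).
Proof. by apply: continuous_compact_integrable; exact: segment_compact. Qed.

Lemma Rintegral_expR_affine a b p q : a < b -> p != 0 ->
  \int[mu]_(t in `[a, b]) expR (p * t + q) =
  (expR (p * b + q) - expR (p * a + q)) / p.
Proof.
move=> ab p0; pose F t := expR (p * t + q) / p.
have dF t : is_derive t 1 F (expR (p * t + q)).
  rewrite /F; apply: is_derive_eq.
  by rewrite /GRing.scale/=; field.
have cF : continuous F.
  by move=> t; apply/differentiable_continuous/derivable1_diffP.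
have cf : continuous (fun t => expR (p * t + q)).
  move=> t; apply: (@continuous_comp _ _ _ (fun t => p * t + q) expR).
    by apply: cvgD; [apply: cvgM; [exact: cvg_cst|exact: cvg_id]|exact: cvg_cst].
  exact: continuous_expR.
rewrite /Rintegral (@continuous_FTC2 _ _ F)//=.
- by rewrite /F -mulrBl.
- exact: continuous_subspaceT.
- split => [t _||]; first by have [] := dF t.
  + exact/cvg_at_right_filter/cF.
  + exact/cvg_at_left_filter/cF.
- by move=> t _; rewrite derive1E; have [] := dF t.
Qed.

Lemma cvg_expRNn eta : 0 < eta -> expR (- (n%:R * eta)) @[n --> \oo] --> (0 : R).
Proof.
move=> e0; under eq_fun do rewrite -mulrN expRM_natl.
by apply: cvg_expr; rewrite ger0_norm ?expR_ge0// -expR0 ltr_expR oppr_lt0.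
Qed.

Lemma cvg_natM_expRNn eta : 0 < eta ->
  n%:R * expR (- (n%:R * eta)) @[n --> \oo] --> (0 : R).
Proof.
move=> e0; pose C := 4 / eta ^+ 2.
apply: (@squeeze_cvgr _ _ _ _ (cst 0) (fun n => C * n%:R^-1)).
(* [expR (2 * u) >= u ^+ 2] with [u = n * eta / 2] bounds the sequence by [C / n]. *)
- exists 1%N => // n /= n0; have n0' : 0 < n%:R :> R by rewrite ltr0n.
  rewrite mulr_ge0 ?expR_ge0//= expRN ler_pdivrMr ?expR_gt0//.
  pose u := n%:R * eta / 2; have u0 : 0 <= u by rewrite /u divr_ge0// mulr_ge0 ?ltW.
  have -> : n%:R * eta = u + u by rewrite /u; field.
  rewrite expRD (@le_trans _ _ (C * n%:R^-1 * (u * u)))//.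
    by rewrite /C /u le_eqVlt; apply/orP; left; apply/eqP; field; rewrite !gt_eqF.
  have uexp : u <= expR u by rewrite (le_trans _ (expR_ge1Dx _))// lerDr.
  by rewrite ler_wpM2l ?ler_pM// mulr_ge0 ?invr_ge0 ?ler0n// divr_ge0 ?sqr_ge0.
- exact: cvg_cst.
- rewrite -[X in _ --> X](mulr0 C); apply: cvgM; first exact: cvg_cst.
  by rewrite -cvg_shiftS; exact: cvg_harmonic.
Qed.

Lemma Rintegral_expR_left a b k : a < b -> k != 0 ->
  \int[mu]_(t in `[a, b]) expR (- (k * `|t - a|)) =
  (1 - expR (- (k * (b - a)))) / k.
Proof.
move=> ab k0; transitivity (\int[mu]_(t in `[a, b]) expR (- k * t + k * a)).
  apply: eq_Rintegral => t; rewrite inE/= in_itv/= => /andP[at_ _].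
  by rewrite ger0_norm ?subr_ge0//; congr expR; ring.
rewrite Rintegral_expR_affine ?oppr_eq0//.
have -> : - k * a + k * a = 0 by ring.
have -> : - k * b + k * a = - (k * (b - a)) by ring.
by rewrite expR0; field.
Qed.

Lemma Rintegral_expR_right a b k : a < b -> k != 0 ->
  \int[mu]_(t in `[a, b]) expR (- (k * `|t - b|)) =
  (1 - expR (- (k * (b - a)))) / k.
Proof.
move=> ab k0; transitivity (\int[mu]_(t in `[a, b]) expR (k * t - k * b)).
  apply: eq_Rintegral => t; rewrite inE/= in_itv/= => /andP[_ tb].
  by rewrite ler0_norm ?subr_le0//; congr expR; ring.
rewrite Rintegral_expR_affine//.
have -> : k * b - k * b = 0 by ring.
have -> : k * a - k * b = - (k * (b - a)) by ring.
by rewrite expR0.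
Qed.

(** Multiplied by [n], an exponential peak of slope [c] has mass [1 / c] in the
limit, and not [2 / c], because only one side of it lies in the segment. *)
Lemma cvg_Rintegral_expR_endpoint a b c e : a < b -> 0 < c ->
  (e = a) \/ (e = b) ->
  n%:R * \int[mu]_(t in `[a, b]) expR (- (n%:R * c * `|t - e|)) @[n --> \oo]
    --> c^-1.
Proof.
move=> ab c0 eab.
suff : (1 - expR (- (n%:R * (c * (b - a))))) / c @[n --> \oo] --> (1 - 0) / c.
  rewrite subr0 div1r; apply: cvg_trans; apply: near_eq_cvg.
  exists 1%N => // n /= n0.
  have n0' : n%:R != 0 :> R by rewrite pnatr_eq0 -lt0n.
  have nc0 : n%:R * c != 0 by rewrite mulf_neq0// gt_eqF.
  have -> : \int[mu]_(t in `[a, b]) expR (- (n%:R * c * `|t - e|)) =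
      (1 - expR (- (n%:R * c * (b - a)))) / (n%:R * c).
    by case: eab => ->; [exact: Rintegral_expR_left|exact: Rintegral_expR_right].
  rewrite -(mulrA n%:R c (b - a)); move: (expR _) => E.
  by rewrite invfM mulrCA mulVKf.
apply: cvgM; last exact: cvg_cst.
apply: cvgB; first exact: cvg_cst.
by apply: cvg_expRNn; rewrite mulr_gt0// subr_gt0.
Qed.

End exponential_integrals.

(** * Laplace's method with two maxima at the endpoints *)

Section laplace.
Context {R : realType}.
Implicit Types (a b c d e t eps delta eta phit : R).
Local Notation mu := (@lebesgue_measure R).

(** The model of the integrand [phi t * expR (psi n t)] near the endpoint [e],
where [phi e = phi0] and [psi n t] is close to [d - n * c * |t - e|].  The
parameter [eps] is signed: [peak] with [eps] is an upper bound of the integrand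
and [peak] with [- eps] a lower bound, so that one function of [eps] describes
the limits of both bounds. *)
Definition peak (phi0 d c : R) (e : R) (eps : R) (n : nat) (t : R) : R :=
  (phi0 + eps) * expR (d + eps) * expR (- (n%:R * (c - eps) * `|t - e|)).

(** When [phi0 - eps] is negative, the lower peak is negative and the lower bound
holds because the integrand is nonnegative. *)
Lemma peak_near phi0 d c e eps n t phit (psi : R) :
  0 <= phit -> `|phit - phi0| <= eps ->
  `|psi - (d - n%:R * c * `|t - e|)| <= eps + n%:R * eps * `|t - e| ->
  peak phi0 d c e (- eps) n t <= phit * expR psi <= peak phi0 d c e eps n t.
Proof.
move=> phit0; rewrite ler_distl => /andP[phil phir].
rewrite ler_distl => /andP[psil psir].
rewrite /peak -![_ * expR _ * expR _]mulrA -!expRD; apply/andP; split.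
- have [p0|p0] := leP 0 (phi0 - eps).
    apply: ler_pM => //; rewrite ?expR_ge0//.
    by rewrite ler_expR (le_trans _ psil)// le_eqVlt; apply/orP; left; apply/eqP; ring.
  by rewrite (@le_trans _ _ 0)// ?mulr_ge0 ?expR_ge0// mulr_le0_ge0 ?expR_ge0// ltW.
- apply: ler_pM; rewrite ?expR_ge0//.
  by rewrite ler_expR (le_trans psir)// le_eqVlt; apply/orP; left; apply/eqP; ring.
Qed.

Lemma peak_ge0 phi0 d c e eps n t : 0 <= phi0 -> 0 <= eps ->
  0 <= peak phi0 d c e eps n t.
Proof. by move=> p0 e0; rewrite /peak !mulr_ge0 ?expR_ge0// addr_ge0. Qed.

(** At distance from [e] the lower peak is exponentially small; this allows both
lower peaks to be subtracted on the whole segment. *)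
Lemma peak_far phi0 d c e eps eta n t : 0 <= phi0 -> 0 <= eps -> 0 <= c ->
  eta <= c * `|t - e| ->
  peak phi0 d c e (- eps) n t <= phi0 * expR d * expR (- (n%:R * eta)).
Proof.
move=> p0 e0 c0 ct; rewrite /peak.
have h1 : expR (- (n%:R * (c - - eps) * `|t - e|)) <= expR (- (n%:R * eta)).
  rewrite ler_expR lerN2 -mulrA ler_wpM2l// (le_trans ct)// ler_wpM2r//.
  by rewrite opprK lerDl.
have h2 : expR (d - eps) <= expR d by rewrite ler_expR gerBl.
have [pe|pe] := leP 0 (phi0 - eps).
  by rewrite !ler_pM ?mulr_ge0 ?expR_ge0 ?gerBl.
rewrite (@le_trans _ _ 0)// ?mulr_ge0 ?expR_ge0//.
by rewrite -mulrA mulr_le0_ge0 ?mulr_ge0 ?expR_ge0// ltW.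
Qed.

Lemma peak_continuous phi0 d c e eps n : continuous (peak phi0 d c e eps n).
Proof.
move=> t; rewrite /peak; apply: cvgM; first exact: cvg_cst.
apply: (@continuous_comp _ _ _ (fun t => - (n%:R * (c - eps) * `|t - e|)) expR).
  apply: cvgN; apply: cvgM; first exact: cvg_cst.
  by apply: cvg_norm; apply: cvgB; [exact: cvg_id|exact: cvg_cst].
exact: continuous_expR.
Qed.

Lemma cvg_Rintegral_peak phi0 d c a b e eps : a < b -> eps < c ->
  (e = a) \/ (e = b) ->
  n%:R * \int[mu]_(t in `[a, b]) peak phi0 d c e eps n t @[n --> \oo]
    --> (phi0 + eps) * expR (d + eps) / (c - eps).
Proof.
move=> ab ec eab; have ce0 : 0 < c - eps by rewrite subr_gt0.
have := cvg_Rintegral_expR_endpoint ab ce0 eab.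
move=> /(cvgM (cvg_cst ((phi0 + eps) * expR (d + eps)))).
apply: cvg_trans; apply: near_eq_cvg; apply: nearW => n /=.
rewrite RintegralZl//; first by rewrite mulrCA.
apply: within_continuous_integrable; apply: continuous_subspaceT => t.
apply: (@continuous_comp _ _ _ (fun t => - (n%:R * (c - eps) * `|t - e|)) expR).
  apply: cvgN; apply: cvgM; first exact: cvg_cst.
  by apply: cvg_norm; apply: cvgB; [exact: cvg_id|exact: cvg_cst].
exact: continuous_expR.
Qed.

(** Adding the two peaks gives bounds on the whole segment: near an endpoint the
peak of the other one only costs an exponentially small error, and so do both
peaks in the middle.  The integrals of the bounds tend to [L eps] and
[L (- eps)], where [L] is continuous at 0 and [L 0] is the announced limit. *)
Lemma laplace_endpoints a b (da db ca cb : R) (phi : R -> R) (psi : nat -> R -> R) :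
  a < b -> 0 < ca -> 0 < cb ->
  {within `[a, b]%classic, continuous phi} ->
  (forall t, t \in `[a, b] -> 0 <= phi t) ->
  (\forall n \near \oo, {within `[a, b]%classic, continuous (psi n)}) ->
  (forall eps, 0 < eps -> exists2 delta : R, 0 < delta & \forall n \near \oo,
     forall t, t \in `[a, b] -> `|t - a| <= delta ->
     `|psi n t - (da - n%:R * ca * `|t - a|)| <= eps + n%:R * eps * `|t - a|) ->
  (forall eps, 0 < eps -> exists2 delta : R, 0 < delta & \forall n \near \oo,
     forall t, t \in `[a, b] -> `|t - b| <= delta ->
     `|psi n t - (db - n%:R * cb * `|t - b|)| <= eps + n%:R * eps * `|t - b|) ->
  (forall delta, 0 < delta -> exists2 eta : R, 0 < eta & \forall n \near \oo,
     forall t, t \in `[a, b] -> delta <= `|t - a| -> delta <= `|t - b| ->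
     phi t = 0 \/ psi n t <= - (n%:R * eta)) ->
  n%:R * \int[mu]_(t in `[a, b]) (phi t * expR (psi n t)) @[n --> \oo] -->
    phi a * expR da / ca + phi b * expR db / cb.
Proof.
move=> ab ca0 cb0 cphi phi0 cpsi psia psib psiaway.
have aab : a \in `[a, b] by rewrite in_itv/= lexx ltW.
have bab : b \in `[a, b] by rewrite in_itv/= lexx ltW.
have pa0 := phi0 _ aab; have pb0 := phi0 _ bab.
pose S eps n t := peak (phi a) da ca a eps n t + peak (phi b) db cb b eps n t.
have [C0 C00 C0P] := within_continuous_bounded ab cphi.
pose C := C0 + phi a * expR da + phi b * expR db.
have Ca0 : 0 <= phi a * expR da by rewrite mulr_ge0 ?expR_ge0.
have Cb0 : 0 <= phi b * expR db by rewrite mulr_ge0 ?expR_ge0.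
have sandwich eps : 0 < eps -> exists2 eta : R, 0 < eta & \forall n \near \oo,
    forall t, t \in `[a, b] ->
    S (- eps) n t - C * expR (- (n%:R * eta)) <= phi t * expR (psi n t)
      <= S eps n t + C * expR (- (n%:R * eta)).
  move=> e0.
  have [ra ra0 raP] := (within_continuousP _ _).1 cphi a aab eps e0.
  have [rb rb0 rbP] := (within_continuousP _ _).1 cphi b bab eps e0.
  have [sa sa0 saP] := psia eps e0.
  have [sb sb0 sbP] := psib eps e0.
  pose delta := Num.min (Num.min (Num.min ra rb) (Num.min sa sb)) ((b - a) / 2).
  have delta0 : 0 < delta by rewrite !lt_min ra0 rb0 sa0 sb0 divr_gt0// subr_gt0.
  have [eta1 eta10 awayP] := psiaway delta delta0.
  pose eta := Num.min eta1 (Num.min (ca * delta) (cb * delta)).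
  have eta0 : 0 < eta by rewrite !lt_min eta10 !mulr_gt0.
  exists eta => //; near=> n => t tab.
  have nearP : phi t * expR (psi n t) >= 0 by rewrite mulr_ge0 ?expR_ge0 ?phi0.
  set E := expR (- (n%:R * eta)); have E0 : 0 <= E by exact: expR_ge0.
  have far_a : delta <= `|t - a| ->
      peak (phi a) da ca a (- eps) n t <= phi a * expR da * E.
    move=> dt; apply: peak_far; rewrite ?(ltW e0) ?(ltW ca0)//.
    rewrite (@le_trans _ _ (ca * delta))//; last by rewrite ler_wpM2l// ltW.
    by rewrite /eta !ge_min lexx !orbT.
  have far_b : delta <= `|t - b| ->
      peak (phi b) db cb b (- eps) n t <= phi b * expR db * E.
    move=> dt; apply: peak_far; rewrite ?(ltW e0) ?(ltW cb0)//.
    rewrite (@le_trans _ _ (cb * delta))//; last by rewrite ler_wpM2l// ltW.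
    by rewrite /eta !ge_min lexx !orbT.
  have up_a := peak_ge0 da ca a n t pa0 (ltW e0).
  have up_b := peak_ge0 db cb b n t pb0 (ltW e0).
  have C0E : 0 <= C0 * E by rewrite mulr_ge0// ltW.
  have aE : 0 <= phi a * expR da * E by rewrite mulr_ge0.
  have bE : 0 <= phi b * expR db * E by rewrite mulr_ge0.
  have CE : C * E = C0 * E + phi a * expR da * E + phi b * expR db * E.
    by rewrite /C !mulrDl.
  have delta_half : delta <= (b - a) / 2 by rewrite /delta ge_min lexx orbT.
  (* As [delta <= (b - a) / 2], a point near [a] is far from [b]. *)
  have [ta|ta] := leP `|t - a| delta.
    have tb : delta <= `|t - b|.
      move: ta tab; rewrite in_itv/= ler_distl => /andP[_ ?] /andP[_ ?].
      by rewrite ler0_norm; lra.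
    have phia : `|phi t - phi a| <= eps.
      by apply: raP => //; rewrite (le_trans ta)// /delta !ge_min lexx.
    have psian : `|psi n t - (da - n%:R * ca * `|t - a|)| <= eps + n%:R * eps * `|t - a|.
      have tsa : `|t - a| <= sa by rewrite (le_trans ta)// /delta !ge_min lexx !orbT.
      by move: (t) tab tsa; near: n; exact: saP.
    have /andP[? ?] := peak_near (phi0 _ tab) phia psian.
    by have := far_b tb; rewrite /S CE; lra.
  have [tb|tb] := leP `|t - b| delta.
    have phib : `|phi t - phi b| <= eps.
      by apply: rbP => //; rewrite (le_trans tb)// /delta !ge_min lexx !orbT.
    have psibn : `|psi n t - (db - n%:R * cb * `|t - b|)| <= eps + n%:R * eps * `|t - b|.
      have tsb : `|t - b| <= sb by rewrite (le_trans tb)// /delta !ge_min lexx !orbT.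
      by move: (t) tab tsb; near: n; exact: sbP.
    have /andP[? ?] := peak_near (phi0 _ tab) phib psibn.
    by have := far_a (ltW ta); rewrite /S CE; lra.
  have : phi t * expR (psi n t) <= C0 * E.
    have : phi t = 0 \/ psi n t <= - (n%:R * eta1).
      by move: (t) tab (ltW ta) (ltW tb); near: n; exact: awayP.
    move=> [->|psit]; first by rewrite mul0r.
    apply: ler_pM; rewrite ?phi0 ?expR_ge0//.
      by rewrite (le_trans (ler_norm _))// C0P.
    rewrite ler_expR (le_trans psit)// lerN2 ler_wpM2l//.
    by rewrite /eta ge_min lexx.
  by have := far_a (ltW ta); have := far_b (ltW tb); rewrite /S CE; lra.
pose L eps := (phi a + eps) * expR (da + eps) / (ca - eps)
            + (phi b + eps) * expR (db + eps) / (cb - eps).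
have L0 : phi a * expR da / ca + phi b * expR db / cb = L 0.
  by rewrite /L !addr0 !subr0.
have cL : {for 0, continuous L}.
  have cl (p q r : R) : 0 < r -> {for 0, continuous (fun eps => (p + eps) * expR (q + eps) / (r - eps))}.
    move=> r0; apply: cvgM; first apply: cvgM.
    - by apply: cvgD; [exact: cvg_cst|exact: cvg_id].
    - apply: (@continuous_comp _ _ _ (fun eps => q + eps) expR).
        by apply: cvgD; [exact: cvg_cst|exact: cvg_id].
      exact: continuous_expR.
    - apply: cvgV; first by rewrite subr0 gt_eqF.
      by apply: cvgB; [exact: cvg_cst|exact: cvg_id].
  by apply: cvgD; exact: cl.
pose I f := \int[mu]_(t in `[a, b]) f t.
have cS eps n : {within `[a, b]%classic, continuous (S eps n)}.
  apply: continuous_subspaceT => t; apply: cvgD; exact: peak_continuous.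
have IS eps : eps < ca -> eps < cb -> n%:R * I (S eps n) @[n --> \oo] --> L eps.
  move=> ea eb.
  rewrite (_ : (fun n => _) = fun n =>
    n%:R * I (peak (phi a) da ca a eps n) + n%:R * I (peak (phi b) db cb b eps n)).
    by apply: cvgD; apply: cvg_Rintegral_peak => //; [left|right].
  apply/funext => n; rewrite -mulrDr /I -RintegralD//.
  - apply: within_continuous_integrable; apply: continuous_subspaceT.
    exact: peak_continuous.
  - apply: within_continuous_integrable; apply: continuous_subspaceT.
    exact: peak_continuous.
have Icst k : I (fun=> k) = k * (b - a).
  by rewrite /I Rintegral_cst//= lebesgue_measure_itv/= lte_fin ab.
rewrite L0; apply/cvgrPdist_le => e e0.
have /cvgrPdist_le /(_ (e / 2)) := cL; rewrite divr_gt0// => /(_ isT).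
move=> /nbhs_ballP[r /= r0 rP].
pose eps := Num.min (r / 2) (Num.min (ca / 2) (cb / 2)).
have eps0 : 0 < eps by rewrite !lt_min !divr_gt0.
have half (x : R) : 0 < x -> x / 2 < x by lra.
have epsr : eps < r by rewrite /eps gt_min half.
have epsa : eps < ca by rewrite /eps !gt_min (half ca)// !orbT.
have epsb : eps < cb by rewrite /eps !gt_min (half cb)// !orbT.
have LP : `|L 0 - L eps| <= e / 2.
  by apply: rP; rewrite /ball/= sub0r normrN ger0_norm// ltW.
have LN : `|L 0 - L (- eps)| <= e / 2.
  by apply: rP; rewrite /ball/= sub0r !normrN ger0_norm// ltW.
have [eta eta0 etaP] := sandwich eps eps0.
have rest : n%:R * (C * expR (- (n%:R * eta)) * (b - a)) @[n --> \oo] --> (0 : R).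
  rewrite (_ : (fun n => _) = fun n =>
    C * (b - a) * (n%:R * expR (- (n%:R * eta)))); last by apply/funext => n; ring.
  rewrite -(mulr0 (C * (b - a))); apply: cvgM; first exact: cvg_cst.
  exact: cvg_natM_expRNn.
have upper : n%:R * I (S eps n) + n%:R * (C * expR (- (n%:R * eta)) * (b - a))
    @[n --> \oo] --> L eps + 0.
  by apply: cvgD rest; exact: IS.
have lower : n%:R * I (S (- eps) n) - n%:R * (C * expR (- (n%:R * eta)) * (b - a))
    @[n --> \oo] --> L (- eps) - 0.
  by apply: cvgB rest; apply: IS; rewrite (lt_trans _ (_ : 0 < _))// oppr_lt0.
rewrite addr0 in upper; rewrite subr0 in lower.
have e20 : 0 < e / 2 by rewrite divr_gt0.
move/cvgrPdist_le : upper => /(_ _ e20) upper.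
move/cvgrPdist_le : lower => /(_ _ e20) lower.
near=> n.
have cpsin : {within `[a, b]%classic, continuous (psi n)} by near: n.
have cF :
    {within `[a, b]%classic, continuous (fun t => phi t * expR (psi n t))}.
  apply: within_continuousM => //; apply: within_continuous_comp cpsin _.
  by move=> x _; exact: continuous_expR.
have SN t : t \in `[a, b] ->
    S (- eps) n t - C * expR (- (n%:R * eta)) <= phi t * expR (psi n t)
      <= S eps n t + C * expR (- (n%:R * eta)).
  by move: t; near: n; exact: etaP.
have up : `|L eps - (n%:R * I (S eps n)
    + n%:R * (C * expR (- (n%:R * eta)) * (b - a)))| <= e / 2 by near: n.
have lo : `|L (- eps) - (n%:R * I (S (- eps) n)
    - n%:R * (C * expR (- (n%:R * eta)) * (b - a)))| <= e / 2 by near: n.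
move: SN up lo; set K := C * _ => SN up lo.
have ccst k : {within `[a, b]%classic, continuous (fun=> k : R)}.
  by apply: continuous_subspaceT => x; exact: cvg_cst.
have hiI : I (fun t => phi t * expR (psi n t)) <= I (S eps n) + K * (b - a).
  rewrite -Icst /I -RintegralD//; last 2 first.
  - exact: within_continuous_integrable.
  - exact: within_continuous_integrable.
  apply: le_Rintegral => //; try exact: within_continuous_integrable.
  - by apply: within_continuous_integrable; exact: within_continuousD.
  - by move=> t /= /SN /andP[].
have loI : I (S (- eps) n) - K * (b - a) <= I (fun t => phi t * expR (psi n t)).
  rewrite -Icst /I -RintegralB//; last 2 first.
  - exact: within_continuous_integrable.
  - exact: within_continuous_integrable.
  apply: le_Rintegral => //; try exact: within_continuous_integrable.
  - by apply: within_continuous_integrable; exact: (within_continuousD (cS _ _) (ccst (- K))).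
  - by move=> t /= /SN /andP[].
have n0 : 0 <= n%:R :> R by [].
have {}hiI := ler_wpM2l n0 hiI; have {}loI := ler_wpM2l n0 loI.
rewrite mulrDr in hiI; rewrite mulrBr in loI.
move: LP LN up lo; rewrite !ler_distl -/(I (fun t => phi t * expR (psi n t))).
by move=> /andP[? ?] /andP[? ?] /andP[? ?] /andP[? ?]; apply/andP; split; lra.
Unshelve. all: by end_near. Qed.

End laplace.

(** * Mean hitting times are at least one *)

Section mean_hitting_time.
Context {R : realType}.
Import HBNNSimple.

(** Almost surely the chain starts outside [T], so the hitting time is at least
the indicator of the event that the chain starts at [x0].  The bound is read
off the definition of the integral as a supremum over simple functions, which
avoids the measurability of the hitting time. *)
Lemma mean_hitting_time_ge1 (U : choiceType) (S : {fset U}) (Q : S -> S -> R)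
    (x0 : U) (T : {fset U}) (v : R) :
  x0 \notin T -> is_mean_hitting_time Q x0 T v -> 1 <= v.
Proof.
move=> x0T [d [Om [P [Z [[mZ _] P1 vE]]]]].
set A := [set om | val (Z 0%N om) = x0] in P1.
have mA : measurable A.
  have [om Aom] : A !=set0.
    apply/set0P/negP => /eqP A0; move: P1; rewrite A0 measure0 => /eqP.
    by rewrite eqe eq_sym oner_eq0.
  rewrite (_ : A = Z 0%N @^-1` [set Z 0%N om]); first exact: mZ.
  apply/seteqP; split=> om' /=; rewrite /A/= => Aom'.
    by apply: val_inj; exact: etrans Aom' (esym Aom).
  by rewrite Aom'.
rewrite -lee_fin -vE -P1 -(setIT A) -integral_indic//.
set H := hitting_time R _ Z.
have H0 om : (0 <= H om)%E.
  by apply: le_ereal_inf_tmp => _ [n _ <-]; rewrite lee_fin.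
rewrite [leRHS]ge0_integralTE//; apply: ereal_sup_ubound.
exists (indic_nnsfun R mA).
  move=> om /=; rewrite mindicE; case: (boolP (om \in A)) => // /[!inE] Aom.
  apply: le_ereal_inf_tmp => _ [n Tn <-]; rewrite lee_fin ler1n lt0n.
  by apply/eqP => n0; move: x0T; rewrite -Aom -n0 Tn.
by rewrite -integralT_nnsfun.
Qed.

End mean_hitting_time.

(** * The support of a measure with continuous density *)

Section support.
Context {R : realType}.
Implicit Types (a b t : R) (g : R -> R).

Lemma msupport_closed a b (mu : set (measurableTypeR R) -> \bar R) :
  closed (msupport `[a, b]%classic mu).
Proof.
move=> t clt; split.
  apply: (@itv_closed _ R a b); move: clt; apply: closure_subset.
  by move=> s [].
move=> V oV Vt; have [s [[_ sP] Vs]] := clt V (open_nbhs_nbhs (conj oV Vt)).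
exact: sP.
Qed.

(** By continuity [g] is at least [g t / 2] on a nondegenerate interval around
[t], which fits in any neighbourhood of [t]. *)
Lemma density_gt0_msupport a b (mu : {measure set (measurableTypeR R) -> \bar R})
    g t :
  a < b -> {within `[a, b]%classic, continuous g} ->
  has_density `[a, b]%classic mu g -> t \in `[a, b] -> 0 < g t ->
  msupport `[a, b]%classic mu t.
Proof.
move=> ab cg [g0 gE] tab gt0; split=> // V oV Vt.
have [r r0 rP] := (within_continuousP _ _).1 cg t tab (g t / 2) (divr_gt0 gt0 (ltr0Sn R 1)).
have /nbhs_ballP[s /= s0 sV] := open_nbhs_nbhs (conj oV Vt).
pose e := Num.min r (s / 2); have e0 : 0 < e by rewrite lt_min r0 divr_gt0.
pose u := Num.max a (t - e); pose v := Num.min b (t + e).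
have uv : u < v.
  move: tab; rewrite in_itv/= => /andP[? ?].
  by rewrite /u /v gt_max !lt_min; apply/andP; split; apply/andP; split; lra.
have uvP x : x \in `[u, v] -> x \in `[a, b] /\ `|x - t| <= e.
  rewrite !in_itv/= /u /v ge_max le_min => /andP[/andP[-> ?] /andP[-> ?]].
  by split => //; rewrite ler_distl; apply/andP.
have gJ x : x \in `[u, v] -> g t / 2 <= g x.
  move=> /uvP[xab xe]; have := rP x xab; rewrite (le_trans xe) ?ge_min ?lexx//.
  by move=> /(_ isT); rewrite ler_distl => /andP[+ _]; lra.
have mJ : measurable (`[u, v]%classic : set (measurableTypeR R)) by [].
have JV : `[u, v]%classic `<=` V `&` `[a, b]%classic.
  move=> x /= /uvP[xab xe]; split=> //; apply: sV.
  rewrite /ball/= distrC (le_lt_trans xe)// gt_min; apply/orP; right.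
  by rewrite ltr_pdivrMr// ltr_pMr// ltr1n.
have mV : measurable (V `&` `[a, b]%classic : set (measurableTypeR R)).
  by apply: measurableI => //; exact: open_measurable.
apply: (@lt_le_trans _ _ (mu `[u, v]%classic)); last by apply: le_measure; rewrite ?inE.
rewrite gE//; last by move=> x /JV[].
apply: (@lt_le_trans _ _ (\int[lebesgue_measure]_(x in `[u, v]) (g t / 2)%:E)%E).
  rewrite integral_cst//= lebesgue_measure_itv/= lte_fin uv -EFinB -EFinM lte_fin.
  by rewrite mulr_gt0 ?divr_gt0// subr_gt0.
apply: ge0_le_integral => //=.
- by move=> x _; rewrite lee_fin divr_ge0// ltW.
- apply/measurable_EFinP; apply: subspace_continuous_measurable_fun => //.
  by apply: continuous_subspaceW cg => x /JV[].
Qed.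

End support.

(** * Asymptotics of the exponent *)

Section endpoint.
Context {R : realType}.
Implicit Types (a b e t eps : R) (h : R -> R).

(** Decompose [h_N t - h e] into [h_N e - h e], which contributes [d], and
[h_N t - h_N e], to which the mean value theorem applies; the derivative of
[h_N] at the intermediate point is close to that of [h] there by uniform
convergence, and the latter is close to [h'(e)] by continuity. *)
Lemma scaled_increment_expansion a b e (d : R) h (hN : nat -> R -> R) :
  e \in `[a, b] -> C1_in `[a, b]%classic h ->
  (\forall N \near \oo, {within `[a, b]%classic, continuous (hN N)}) ->
  N%:R * (hN N e - h e) @[N --> \oo] --> d ->
  (exists2 delta0 : R, 0 < delta0 & forall delta : R, 0 < delta < delta0 ->
     let W := `[e - delta, e + delta]%classic `&` `[a, b]%classic in
     (\forall N \near \oo, forall t, W t -> derivable_in `[a, b]%classic (hN N) t) /\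
     ereal_sup [set `|derive_in `[a, b]%classic (hN N) t
                      - derive_in `[a, b]%classic h t|%:E | t in W]
       @[N --> \oo] --> 0%E) ->
  forall eps, 0 < eps -> exists2 delta : R, 0 < delta & \forall N \near \oo,
    forall t, t \in `[a, b] -> `|t - e| <= delta ->
    `|N%:R * (hN N t - h e) - (d + N%:R * (derive_in `[a, b]%classic h e * (t - e)))|
      <= eps + N%:R * eps * `|t - e|.
Proof.
move=> eab [_ ch'] chN hd [delta0 delta00 hdh] eps eps0.
have eps20 : 0 < eps / 2 by rewrite divr_gt0.
have [r r0 rP] := (within_continuousP _ _).1 ch' e eab _ eps20.
pose delta := Num.min r (delta0 / 2).
have delta_gt0 : 0 < delta by rewrite lt_min r0 divr_gt0.
have delta_lt : 0 < delta < delta0.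
  by rewrite delta_gt0/= gt_min; apply/orP; right; lra.
have [dN supN] := hdh delta delta_lt.
move: dN supN; set W := _ `&` _ => dN supN.
have {}supN : \forall N \near \oo, forall t, W t ->
    `|derive_in `[a, b]%classic (hN N) t - derive_in `[a, b]%classic h t| <= eps / 2.
  have nb : nbhs (0%:E : \bar R)%E [set y | (y < (eps / 2)%:E)%E].
    exact (@nbhs_open_ereal_lt R 0 (fun=> eps / 2) eps20).
  pose F N := ereal_sup [set `|derive_in `[a, b]%classic (hN N) t
    - derive_in `[a, b]%classic h t|%:E | t in W].
  have : \forall N \near \oo, (F N < (eps / 2)%:E)%E by exact: (supN _ nb).
  apply: filterS => N /ltW supN' t Wt.
  rewrite -lee_fin (le_trans _ supN')//; apply: ereal_sup_ubound.
  by exists t.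
have {}hd : \forall N \near \oo, `|N%:R * (hN N e - h e) - d| <= eps.
  by move/cvgrPdist_le : hd => /(_ _ eps0); apply: filterS => N; rewrite distrC.
exists delta => //; near=> N => t tab te.
have WP s : s \in `[a, b] -> `|s - e| <= delta -> W s.
  by move=> sab; rewrite ler_distl => se; split.
have chNN : {within `[a, b]%classic, continuous (hN N)} by near: N.
have [s sab se] : exists2 c, (c \in `[a, b]) && (`|c - e| <= `|t - e|) &
    hN N t - hN N e = derive_in `[a, b]%classic (hN N) c * (t - e).
  apply: MVT_in => // s sab st.
  have Ws : W s by apply: WP => //; exact: le_trans st te.
  by move: s Ws {sab st}; near: N.
move: sab => /andP[sab ste].
have sd : `|s - e| <= delta by exact: le_trans ste te.
have h1 : `|derive_in `[a, b]%classic (hN N) s - derive_in `[a, b]%classic h s| <= eps / 2.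
  by move: (s) (WP _ sab sd); near: N.
have h2 : `|derive_in `[a, b]%classic h s - derive_in `[a, b]%classic h e| <= eps / 2.
  by apply: rP => //; rewrite (le_trans sd)// ge_min lexx.
have h3 : `|N%:R * (hN N e - h e) - d| <= eps by near: N.
have -> : N%:R * (hN N t - h e) - (d + N%:R * (derive_in `[a, b]%classic h e * (t - e)))
  = (N%:R * (hN N e - h e) - d) + N%:R * ((derive_in `[a, b]%classic (hN N) s
      - derive_in `[a, b]%classic h e) * (t - e)).
  by rewrite mulrBl -se; ring.
rewrite (le_trans (ler_normD _ _))// lerD// !normrM ger0_norm// mulrA.
rewrite ler_wpM2r// ler_wpM2l//.
rewrite -[X in `|X|](subrKA (derive_in `[a, b]%classic h s)).
by rewrite (le_trans (ler_normD _ _))// [leRHS]splitr lerD.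
Unshelve. all: by end_near. Qed.

End endpoint.

Section away.
Context {R : realType}.
Implicit Types (a b e t eps : R) (h : R -> R).

Lemma uniform_near_le a b h (hN : nat -> R -> R) eps :
  {uniform `[a, b]%classic, hN @ \oo --> h} -> 0 < eps ->
  \forall N \near \oo, forall t, t \in `[a, b] -> `|hN N t - h t| <= eps.
Proof.
move=> hu eps0.
have : nbhs (h : {uniform` `[a, b]%classic -> R})
    [set f : R -> R | forall t, t \in `[a, b] -> `|f t - h t| <= eps].
  apply/uniform_nbhs; exists [set xy : R * R | ball xy.1 eps xy.2]; split.
    exact: (entourage_ball _ (PosNum eps0)).
  by move=> f fP t /fP; rewrite /ball/= distrC => /ltW.
by move=> /hu.
Qed.

(** Points of the support at distance at least [delta] from the endpoints form a
compact set on which [h] attains a maximum; this maximum is less than [h a],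
otherwise it would be a third point of the support in the argmax.  Half of the
gap survives the passage from [h] to [h_N]. *)
Lemma scaled_increment_away a b h (hN : nat -> R -> R)
    (mu : set (measurableTypeR R) -> \bar R) :
  a < b -> {within `[a, b]%classic, continuous h} ->
  {uniform `[a, b]%classic, hN @ \oo --> h} ->
  argmax_set `[a, b]%classic h `&` msupport `[a, b]%classic mu = [set a; b] ->
  forall delta, 0 < delta -> exists2 eta : R, 0 < eta & \forall N \near \oo,
    forall t, msupport `[a, b]%classic mu t ->
    delta <= `|t - a| -> delta <= `|t - b| ->
    N%:R * (hN N t - h a) <= - (N%:R * eta).
Proof.
move=> ab ch hu hmax delta delta0.
pose K := msupport `[a, b]%classic mu `&` `[a + delta, b - delta]%classic.
have suppE t : msupport `[a, b]%classic mu t -> delta <= `|t - a| ->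
    delta <= `|t - b| -> K t.
  move=> st; have [] := st; rewrite /= in_itv/= => /andP[at_ tb] _.
  rewrite ger0_norm ?subr_ge0// ler0_norm ?subr_le0// => ? ?.
  by split => //; rewrite /= in_itv/=; apply/andP; split; lra.
(* If [K] is empty there is nothing to bound and any positive [eta] fits. *)
have [K0|K0] := eqVneq K set0.
  exists 1 => //; near=> N => t st ta tb.
  by have := suppE t st ta tb; rewrite K0.
have Kab : K `<=` `[a, b]%classic by move=> t [[]].
have cK : compact K.
  apply: (@subclosed_compact _ _ `[a, b]%classic) => //.
    by apply: closedI; [exact: msupport_closed|exact: itv_closed].
  exact: segment_compact.
have [c Kc cP] := compact_EVT_max ((set0P _).1 K0) cK (continuous_subspaceW Kab ch).
rewrite inE in Kc; have aamax : argmax_set `[a, b]%classic h a.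
  suff : (argmax_set `[a, b]%classic h `&` msupport `[a, b]%classic mu) a by case.
  by rewrite hmax; left.
have hca : h c < h a.
  rewrite ltNge; apply/negP => hac.
  have : (argmax_set `[a, b]%classic h `&` msupport `[a, b]%classic mu) c.
    split; last exact: Kc.1.
    split; first exact: Kab.
    by move=> s sab; rewrite (le_trans _ hac)//; exact: aamax.2.
  have [_] := Kc; rewrite hmax /= in_itv/= => /andP[? ?] [] cE; move: delta0 ab; lra.
pose eta := (h a - h c) / 2; have eta0 : 0 < eta by rewrite divr_gt0// subr_gt0.
exists eta => //; have := uniform_near_le hu eta0; apply: filterS => N NP t st ta tb.
have Kt := suppE t st ta tb.
rewrite -mulrN ler_wpM2l//.
have := NP t (Kab _ Kt); rewrite ler_distl => /andP[_].
have := cP t; rewrite inE => /(_ Kt); rewrite /eta; lra.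
Unshelve. all: by end_near. Qed.

End away.

(** * The weighted laws and their limit as measures *)

Section laws.
Context {R : realType}.
Implicit Types (a b c : R) (f g m : R -> R).
Local Notation T := (measurableTypeR R).
Local Notation leb := (@lebesgue_measure R).

Lemma within_continuous_measurable a b f :
  {within `[a, b]%classic, continuous f} ->
  measurable_fun (`[a, b]%classic : set T) f.
Proof. by move=> cf; exact: subspace_continuous_measurable_fun. Qed.

(** [weighted_law] is only a set function; the theory of the integral applies
after it is identified, as a function, with a measure. *)
Lemma weighted_law_measure (D : set T) (mu : {measure set T -> \bar R})
    (m : R -> R) (c : R) :
  measurable D -> measurable_fun D m -> (forall t, D t -> 0 <= m t) ->
  0 < c -> (\int[mu]_(t in D) (m t)%:E)%E = c%:E ->
  exists2 nu : {measure set T -> \bar R}, weighted_law D mu m = nu &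
    forall f : T -> \bar R, measurable_fun D f -> (forall t, D t -> 0 <= f t)%E ->
      (\int[nu]_(t in D) f t = (c^-1)%:E * \int[mu]_(t in D) (f t * (m t)%:E))%E.
Proof.
move=> mD mm m0 c0 cE.
pose M (A : set T) := (\int[mu]_(t in A `&` D) (m t)%:E)%E.
have ME : M = fun A => (\int[mu]_(t in A) ((EFin \o m) \_ D) t)%E.
  by apply/funext => A; rewrite /M integral_mkcondr.
have mD0 t : (0 <= ((EFin \o m) \_ D) t)%E.
  by rewrite patchE; case: ifPn => // /[!inE] Dt; rewrite lee_fin m0.
have M0 : M set0 = 0%E by rewrite /M set0I integral_set0.
have Mge0 A : (0 <= M A)%E by rewrite ME; exact: integral_ge0.
have Msigma : semi_sigma_additive M.
  rewrite ME; apply: semi_sigma_additive_nng_induced => //.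
  have mEm : measurable_fun D (EFin \o m) by exact/measurable_EFinP.
  exact: (measurable_restrictT (EFin \o m) mD).1 mEm.
pose Mmeas : {measure set T -> \bar R} :=
  HB.pack M (isMeasure.Build _ _ _ M M0 Mge0 Msigma).
have ci0 : 0 <= c^-1 by rewrite invr_ge0 ltW.
exists (mscale (NngNum ci0) Mmeas).
  apply/funext => A; rewrite /weighted_law cE /mscale/= inver gt_eqF//.
  by rewrite muleC.
move=> f mf f0; rewrite ge0_integral_mscale//; congr (_ * _)%E.
apply: ge0_integral_density => // A mA AD.
by rewrite /= /M setIidl.
Qed.

Lemma integral_has_density a b (mu : {measure set T -> \bar R}) f g :
  {within `[a, b]%classic, continuous g} -> has_density `[a, b]%classic mu g ->
  {within `[a, b]%classic, continuous f} ->
  (forall t, t \in `[a, b] -> 0 <= f t) ->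
  (\int[mu]_(t in `[a, b]) (f t)%:E = (\int[leb]_(t in `[a, b]) (f t * g t))%:E)%E.
Proof.
move=> cg [g0 gE] cf f0.
rewrite (@ge0_integral_density _ _ _ leb mu _ g (EFin \o f))//; first last.
- by apply/measurable_EFinP; exact: within_continuous_measurable.
- exact: within_continuous_measurable.
rewrite /Rintegral fineK//; apply: integrable_fin_num => //.
by apply: within_continuous_integrable; exact: within_continuousM.
Qed.

(** The bound [1 <= m] makes the normalizing constant positive. *)
Lemma weighted_law_density a b (mu : {measure set T -> \bar R}) g m :
  mu `[a, b]%classic = 1%E ->
  {within `[a, b]%classic, continuous g} -> has_density `[a, b]%classic mu g ->
  {within `[a, b]%classic, continuous m} ->
  (forall t, t \in `[a, b] -> 1 <= m t) ->
  exists2 nu : {measure set T -> \bar R}, weighted_law `[a, b]%classic mu m = nu &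
    forall f, {within `[a, b]%classic, continuous f} ->
      (forall t, t \in `[a, b] -> 0 <= f t) ->
      (\int[nu]_(t in `[a, b]) (f t)%:E)%E =
      ((\int[leb]_(t in `[a, b]) (f t * m t * g t)) /
       (\int[leb]_(t in `[a, b]) (m t * g t)))%:E.
Proof.
move=> mu1 cg hg cm m1.
have m0 t : t \in `[a, b] -> 0 <= m t by move=> /m1; exact: le_trans.
have mE := integral_has_density cg hg cm m0.
set c := \int[leb]_(t in _) _ in mE *.
have c1 : 1 <= c.
  rewrite -lee_fin -mE -mu1 -[leLHS]mul1e -integral_cst//.
  apply: ge0_le_integral => //=.
  - by apply/measurable_EFinP; exact: within_continuous_measurable.
have c0 : 0 < c by exact: lt_le_trans c1.
have mI : measurable (`[a, b]%classic : set T) by [].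
have [nu nuE nuf] := weighted_law_measure mI (within_continuous_measurable cm) m0 c0 mE.
exists nu => // f cf f0; rewrite nuf//; last first.
  by apply/measurable_EFinP; exact: within_continuous_measurable.
under eq_integral do rewrite -EFinM.
rewrite (integral_has_density cg hg)//.
- by rewrite -EFinM mulrC.
- exact: within_continuousM.
- by move=> t tab; rewrite mulr_ge0 ?f0 ?m0.
Qed.

Lemma dirac_mixture_measure (D : set T) (K : nat) (w theta : 'I_K -> R) :
  measurable D -> (forall i, 0 <= w i) -> (forall i, D (theta i)) ->
  exists2 nu : {measure set T -> \bar R}, dirac_mixture w theta = nu &
    forall f : T -> \bar R, measurable_fun D f -> (forall t, D t -> 0 <= f t)%E ->
      (\int[nu]_(t in D) f t = \sum_(i < K) (w i)%:E * f (theta i))%E.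
Proof.
move=> mD w0 Dtheta.
pose m_ (n : nat) : {measure set T -> \bar R} :=
  if insub n is Some i then mscale (NngNum (w0 i)) (\d_(theta i : T)) else mzero.
exists (msum m_ K).
  apply/funext => A; rewrite /dirac_mixture /msum/=.
  by apply: eq_bigr => i _; rewrite /m_ valK.
move=> f mf f0; rewrite ge0_integral_measure_sum//.
apply: eq_bigr => i _; rewrite /m_ valK ge0_integral_mscale// integral_dirac//.
by rewrite diracE mem_set// mul1e.
Qed.

(** The integral of a continuous function is the difference of the integrals of
its positive and negative parts, which are continuous; finiteness of the limits
makes the difference of the limits meaningful. *)
Lemma weak_cvg_ge0 a b (nu : nat -> set T -> \bar R) (nu' : {measure set T -> \bar R}) :
  (\forall N \near \oo, exists nuN : {measure set T -> \bar R}, nu N = nuN) ->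
  (forall f, {within `[a, b]%classic, continuous f} ->
     (forall t, t \in `[a, b] -> 0 <= f t) ->
     (\int[nu']_(t in `[a, b]) (f t)%:E \is a fin_num)%E /\
     (\int[nu N]_(t in `[a, b]) (f t)%:E)%E @[N --> \oo] -->
       (\int[nu']_(t in `[a, b]) (f t)%:E)%E) ->
  weak_cvg `[a, b]%classic nu nu'.
Proof.
move=> nuM nuP f cf.
pose fp t := Num.max (f t) 0; pose fm t := Num.max (- f t) 0.
have cfp : {within `[a, b]%classic, continuous fp}.
  apply: (@within_continuous_comp _ _ f (fun y => Num.max y 0) cf) => x _.
  by apply: continuous_max; [exact: cvg_id|exact: cvg_cst].
have cfm : {within `[a, b]%classic, continuous fm}.
  apply: (@within_continuous_comp _ _ f (fun y => Num.max (- y) 0) cf) => x _.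
  by apply: continuous_max; [apply: cvgN; exact: cvg_id|exact: cvg_cst].
have fp0 t : t \in `[a, b] -> 0 <= fp t by rewrite le_max lexx orbT.
have fm0 t : t \in `[a, b] -> 0 <= fm t by rewrite le_max lexx orbT.
have split_f (nuN : {measure set T -> \bar R}) :
    (\int[nuN]_(t in `[a, b]) (f t)%:E =
     \int[nuN]_(t in `[a, b]) (fp t)%:E - \int[nuN]_(t in `[a, b]) (fm t)%:E)%E.
  rewrite integralE; congr (_ - _)%E; apply: eq_integral => t _.
    by rewrite funeposE /fp -EFin_max.
  by rewrite funenegE /fm -EFin_max.
have [fpfin fpcvg] := nuP fp cfp fp0; have [fmfin fmcvg] := nuP fm cfm fm0.
rewrite split_f.
have : (\int[nu N]_(t in `[a, b]) (fp t)%:E - \int[nu N]_(t in `[a, b]) (fm t)%:E)%E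
    @[N --> \oo] --> (\int[nu']_(t in `[a, b]) (fp t)%:E - \int[nu']_(t in `[a, b]) (fm t)%:E)%E.
  by apply: cvgeB => //; rewrite fin_num_adde_defl// fin_numN.
apply: cvg_trans; apply: near_eq_cvg.
by apply: filterS nuM => N [nuN ->]; rewrite -split_f.
Qed.

End laws.

(** * Asymptotics of the weighted integrals *)

Section ratio.
Context {R : realType}.
Local Notation leb := (@lebesgue_measure R).

Lemma log_growth_continuous (a b : R) (m : nat -> R -> R) N :
  {within `[a, b]%classic, continuous (m N)} ->
  (forall t, t \in `[a, b] -> 1 <= m N t) ->
  {within `[a, b]%classic, continuous (log_growth m N)}.
Proof.
move=> cm m1; have cln : {within `[a, b]%classic, continuous (fun t => ln (m N t))}.
  apply: within_continuous_comp cm _ => t tab.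
  by apply: continuous_ln; rewrite (lt_le_trans _ (m1 t tab)).
apply: (within_continuousM _ cln); apply: continuous_subspaceT => t.
exact: cvg_cst.
Qed.

Lemma expR_log_growth (m : nat -> R -> R) N (M t : R) : (0 < N)%N -> 0 < m N t ->
  expR (N%:R * (log_growth m N t - M)) = expR (- (N%:R * M)) * m N t.
Proof.
move=> N0 m0; have N0' : N%:R != 0 :> R by rewrite pnatr_eq0 -lt0n.
by rewrite /log_growth mulrBr mulVKf// expRD lnK// mulrC.
Qed.

(** The factor [N * expR (- (N * h a))] brings the integral to order 1; it does
not depend on [f] and cancels in the normalized law.  The middle of the segment
is negligible because [g] vanishes off the support. *)
Lemma laplace_log_growth (a b : R) (m : nat -> R -> R) (g h f : R -> R) (ca cb da db : R)
    (mu : {measure set (measurableTypeR R) -> \bar R}) :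
  a < b ->
  (forall N, (1 <= N)%N -> {within `[a, b]%classic, continuous (m N)}) ->
  (forall N t, (1 <= N)%N -> t \in `[a, b] -> 1 <= m N t) ->
  {within `[a, b]%classic, continuous g} ->
  has_density `[a, b]%classic mu g ->
  {within `[a, b]%classic, continuous f} ->
  (forall t, t \in `[a, b] -> 0 <= f t) ->
  0 < ca -> 0 < cb ->
  (forall eps, 0 < eps -> exists2 delta : R, 0 < delta & \forall N \near \oo,
     forall t, t \in `[a, b] -> `|t - a| <= delta ->
     `|N%:R * (log_growth m N t - h a) - (da - N%:R * ca * `|t - a|)|
       <= eps + N%:R * eps * `|t - a|) ->
  (forall eps, 0 < eps -> exists2 delta : R, 0 < delta & \forall N \near \oo,
     forall t, t \in `[a, b] -> `|t - b| <= delta ->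
     `|N%:R * (log_growth m N t - h a) - (db - N%:R * cb * `|t - b|)|
       <= eps + N%:R * eps * `|t - b|) ->
  {within `[a, b]%classic, continuous h} ->
  {uniform `[a, b]%classic, log_growth m @ \oo --> h} ->
  argmax_set `[a, b]%classic h `&` msupport `[a, b]%classic mu = [set a; b] ->
  N%:R * (expR (- (N%:R * h a)) *
    \int[leb]_(t in `[a, b]) (f t * m N t * g t)) @[N --> \oo] -->
  f a * g a * expR da / ca + f b * g b * expR db / cb.
Proof.
move=> ab cm m1 cg hg cf f0 ca0 cb0 psia psib ch hu hmax.
have [g0 _] := hg.
pose psi N t := N%:R * (log_growth m N t - h a).
have cpsi : \forall N \near \oo, {within `[a, b]%classic, continuous (psi N)}.
  exists 1%N => // N /= N1.
  have cl := log_growth_continuous (cm N N1) (fun t => @m1 N t N1).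
  apply: (@within_continuous_comp _ _ (log_growth m N) (fun y => N%:R * (y - h a)) cl).
  move=> x _; apply: cvgM; first exact: cvg_cst.
  by apply: cvgB; [exact: cvg_id|exact: cvg_cst].
have phi0 t : t \in `[a, b] -> 0 <= f t * g t.
  by move=> tab; rewrite mulr_ge0 ?f0 ?g0.
have away delta : 0 < delta -> exists2 eta : R, 0 < eta & \forall N \near \oo,
    forall t, t \in `[a, b] -> delta <= `|t - a| -> delta <= `|t - b| ->
    f t * g t = 0 \/ psi N t <= - (N%:R * eta).
  move=> delta0; have [eta eta0 etaP] := scaled_increment_away ab ch hu hmax delta0.
  exists eta => //; apply: filterS etaP => N NP t tab ta tb.
  have [->|gt0] := eqVneq (g t) 0; first by left; rewrite mulr0.
  right; apply: NP => //; apply: (density_gt0_msupport ab cg hg tab).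
  by rewrite lt_neqAle eq_sym gt0/=; exact: g0.
have := laplace_endpoints ab ca0 cb0 (within_continuousM cf cg) phi0 cpsi psia psib away.
apply: cvg_trans; apply: near_eq_cvg; exists 1%N => // N /= N1.
congr (_ * _); rewrite -RintegralZl//.
  apply: eq_Rintegral => t; rewrite inE/= => tab.
  rewrite /psi expR_log_growth//; first ring.
  by rewrite (lt_le_trans _ (m1 N t N1 tab)).
apply: within_continuous_integrable; apply: within_continuousM => //.
by apply: within_continuousM => //; exact: cm.
Qed.

End ratio.

Theorem theorem3 (R : realType) (a b : R) (hab : a < b)
    (U : choiceType) (X : nat -> {fset U})
    (hX : forall N, (1 <= N)%N -> (X N `<=` X N.+1)%fset)
    (x0 : U) (hx0 : x0 \in X 1%N)
    (T : nat -> {fset U})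
    (hT : forall N, (1 <= N)%N -> (T N `<=` X N)%fset /\ x0 \notin T N)
    (Q : forall N : nat, R -> X N -> X N -> R)
    (hQ : forall N t, (1 <= N)%N -> t \in `[a, b] ->
       stochastic (Q N t) /\ irreducible (Q N t))
    (m : nat -> R -> R)
    (hm : forall N t, (1 <= N)%N -> t \in `[a, b] ->
       is_mean_hitting_time (Q N t) x0 (T N) (m N t))
    (hm_cont : forall N, (1 <= N)%N -> {within `[a, b]%classic, continuous (m N)})
    (mu : probability (measurableTypeR R) R) (hmu : mu `[a, b]%classic = 1%E)
    (g : R -> R) (hg_cont : {within `[a, b]%classic, continuous g})
    (hg : has_density `[a, b]%classic mu g)
    (hg_pos : 0 < g a /\ 0 < g b)
    (h : R -> R) (h_C1 : C1_in `[a, b]%classic h)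
    (h_unif : {uniform `[a, b]%classic, log_growth m @ \oo --> h})
    (h_argmax : argmax_set `[a, b]%classic h `&` msupport `[a, b]%classic mu = [set a; b])
    (h_ab : h a = h b) (h_pos : 0 < h a)
    (dh_a : derive_in `[a, b]%classic h a < 0) (dh_b : 0 < derive_in `[a, b]%classic h b)
    (d : 'I_2 -> R)
    (hd : forall i : 'I_2, let theta := tnth [tuple a; b] in
       N%:R * (log_growth m N (theta i) - h (theta i)) @[N --> \oo] --> d i)
    (hdh : forall i : 'I_2, let theta := tnth [tuple a; b] in
       exists2 delta0 : R, 0 < delta0 &
       forall delta : R, 0 < delta < delta0 ->
       let W := `[theta i - delta, theta i + delta]%classic `&` `[a, b]%classic in
       (\forall N \near \oo, forall t, W t ->
          derivable_in `[a, b]%classic (log_growth m N) t) /\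
       ereal_sup [set `|derive_in `[a, b]%classic (log_growth m N) t
                        - derive_in `[a, b]%classic h t|%:E | t in W]
         @[N --> \oo] --> 0%E) :
  let theta := tnth [tuple a; b] in
  let r (i : 'I_2) := expR (d i) * g (theta i) / derive_in `[a, b]%classic h (theta i) in
  let w (i : 'I_2) := (-1) ^+ i.+1 * r i / (r ord_max - r ord0) in
  emerging_dominance `[a, b]%classic mu m theta w.
Proof.
move=> theta r w.
have th0 : theta ord0 = a by [].
have th1 : theta ord_max = b by [].
have aab : a \in `[a, b] by rewrite in_itv/= lexx ltW.
have bab : b \in `[a, b] by rewrite in_itv/= lexx ltW.
have m1 N t : (1 <= N)%N -> t \in `[a, b] -> 1 <= m N t.
  by move=> N1 tab; apply: mean_hitting_time_ge1 (hm N t N1 tab); case: (hT N N1).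
have chN : \forall N \near \oo, {within `[a, b]%classic, continuous (log_growth m N)}.
  exists 1%N => // N /= N1; apply: log_growth_continuous; first exact: hm_cont.
  by move=> t; exact: m1.
have ch : {within `[a, b]%classic, continuous h}.
  by apply/within_continuousP => x xab; exact: derivable_in_continuous (h_C1.1 x xab).
have [ga0 gb0] := hg_pos.
pose ca := - derive_in `[a, b]%classic h a; pose cb := derive_in `[a, b]%classic h b.
have ca0 : 0 < ca by rewrite oppr_gt0.
have cb0 : 0 < cb by [].
have psia eps : 0 < eps -> exists2 delta : R, 0 < delta & \forall N \near \oo,
     forall t, t \in `[a, b] -> `|t - a| <= delta ->
     `|N%:R * (log_growth m N t - h a) - (d ord0 - N%:R * ca * `|t - a|)|
       <= eps + N%:R * eps * `|t - a|.
  move=> eps0.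
  have [delta delta0 deltaP] :=
    scaled_increment_expansion aab h_C1 chN (hd ord0) (hdh ord0) eps0.
  exists delta => //; apply: filterS deltaP => N NP t tab ta.
  have := NP t tab ta; rewrite [in X in X -> _](_ : _ * (t - a) = - (ca * `|t - a|)).
    by rewrite mulrN mulrA.
  move: tab; rewrite in_itv/= => /andP[? _].
  by rewrite ger0_norm ?subr_ge0// /ca mulNr opprK.
have psib eps : 0 < eps -> exists2 delta : R, 0 < delta & \forall N \near \oo,
     forall t, t \in `[a, b] -> `|t - b| <= delta ->
     `|N%:R * (log_growth m N t - h a) - (d ord_max - N%:R * cb * `|t - b|)|
       <= eps + N%:R * eps * `|t - b|.
  move=> eps0; rewrite h_ab.
  have [delta delta0 deltaP] :=
    scaled_increment_expansion bab h_C1 chN (hd ord_max) (hdh ord_max) eps0.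
  exists delta => //; apply: filterS deltaP => N NP t tab tb.
  have := NP t tab tb; rewrite [in X in X -> _](_ : _ * (t - b) = - (cb * `|t - b|)).
    by rewrite mulrN mulrA.
  move: tab; rewrite in_itv/= => /andP[_ ?].
  by rewrite ler0_norm ?subr_le0// /cb mulrN opprK.
have r0 : r ord0 < 0.
  by rewrite /r th0 pmulr_rlt0 ?invr_lt0// mulr_gt0 ?expR_gt0.
have r1 : 0 < r ord_max.
  by rewrite /r th1 divr_gt0// mulr_gt0 ?expR_gt0.
have w0E : w ord0 = - r ord0 / (r ord_max - r ord0) by rewrite /w expr1 mulN1r.
have w1E : w ord_max = r ord_max / (r ord_max - r ord0) by rewrite /w sqrrN expr1n mul1r.
have rr : 0 < r ord_max - r ord0 by rewrite subr_gt0 (lt_trans r0).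
have ord2 (i : 'I_2) : i = ord0 \/ i = ord_max.
  by case: i => -[|[|//]] i; [left|right]; exact: val_inj.
have w_gt0 i : 0 < w i.
  by case: (ord2 i) => ->; rewrite ?w0E ?w1E divr_gt0// oppr_gt0.
have supp_ab t : [set a; b] t -> msupport `[a, b]%classic mu t.
  by rewrite -h_argmax => -[].
split.
- move=> i j; case: (ord2 i) => ->; case: (ord2 j) => -> //; rewrite th0 th1 => abE.
    by move: hab; rewrite abE ltxx.
  by move: hab; rewrite abE ltxx.
- split=> [_ [i _ <-]|].
    by apply: supp_ab; case: (ord2 i) => ->; rewrite (th0, th1); [left|right].
  have ga20 : 0 < g a / 2 by rewrite divr_gt0.
  have [delta delta0 deltaP] := (within_continuousP _ _).1 hg_cont a aab _ ga20.
  (* A point distinct from both endpoints, close enough to [a] for [g] to stay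
     positive: it makes the inclusion in the support proper. *)
  pose t := a + Num.min delta ((b - a) / 2).
  have sd : 0 < Num.min delta ((b - a) / 2) by rewrite lt_min delta0 divr_gt0 ?subr_gt0.
  have sb : Num.min delta ((b - a) / 2) <= (b - a) / 2 by rewrite ge_min lexx orbT.
  have tab : t \in `[a, b].
    by rewrite in_itv/= /t; apply/andP; split; move: sd sb hab; lra.
  have gt0 : 0 < g t.
    have := deltaP t tab; rewrite {1}/t addrAC subrr add0r gtr0_norm// ge_min lexx.
    by move=> /(_ isT); rewrite ler_distl => /andP[+ _]; lra.
  move=> /(_ t (density_gt0_msupport hab hg_cont hg tab gt0))[i _].
  by case: (ord2 i) => ->; rewrite (th0, th1) /t; move: sd sb hab; lra.
- exact: w_gt0.
- rewrite big_ord_recl big_ord1 (_ : lift ord0 ord0 = ord_max); last exact: val_inj.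
  by rewrite w0E w1E -mulrDl addrC divff// gt_eqF.
have mI : measurable (`[a, b]%classic : set (measurableTypeR R)) by [].
have thab i : `[a, b]%classic (theta i) by case: (ord2 i) => ->; rewrite (th0, th1).
have [nu' -> nu'f] := dirac_mixture_measure mI (fun i => ltW (w_gt0 i)) thab.
have wl N (N1 : (1 <= N)%N) :=
  weighted_law_density hmu hg_cont hg (hm_cont N N1) (fun t => @m1 N t N1).
apply: weak_cvg_ge0.
  by exists 1%N => // N /= /wl[nuN nuNE _]; exists nuN.
move=> f cf f0.
rewrite nu'f//; last first.
  by apply/measurable_EFinP; exact: within_continuous_measurable.
rewrite big_ord_recl big_ord1 (_ : lift ord0 ord0 = ord_max); last exact: val_inj.
rewrite th0 th1 -!EFinM -EFinD; split => //.
have ratio k ck k0 := @laplace_log_growth _ a b m g h k ca cb (d ord0) (d ord_max) mu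
  hab hm_cont m1 hg_cont hg ck k0 ca0 cb0 psia psib ch h_unif h_argmax.
have c1 : {within `[a, b]%classic, continuous (fun=> 1 : R)}.
  by apply: continuous_subspaceT => x; exact: cvg_cst.
have num := ratio f cf f0.
have den := ratio (fun=> 1) c1 (fun _ _ => ler01).
rewrite !mul1r in den.
pose F k N := N%:R * (expR (- (N%:R * h a)) *
  \int[lebesgue_measure]_(t in `[a, b]) (k t * m N t * g t)).
have L0 : g a * expR (d ord0) / ca + g b * expR (d ord_max) / cb != 0.
  by rewrite gt_eqF// addr_gt0// !(divr_gt0, mulr_gt0) ?expR_gt0.
have lim : F f N / F (fun=> 1) N @[N --> \oo] -->
    (f a * g a * expR (d ord0) / ca + f b * g b * expR (d ord_max) / cb) /
    (g a * expR (d ord0) / ca + g b * expR (d ord_max) / cb).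
  by apply: cvgM; [exact: num|exact: cvgV].
have : (\int[lebesgue_measure]_(t in `[a, b]) (f t * m N t * g t)) /
   (\int[lebesgue_measure]_(t in `[a, b]) (m N t * g t)) @[N --> \oo] -->
   w ord0 * f a + w ord_max * f b.
  rewrite (_ : w ord0 * f a + w ord_max * f b =
    (f a * g a * expR (d ord0) / ca + f b * g b * expR (d ord_max) / cb) /
    (g a * expR (d ord0) / ca + g b * expR (d ord_max) / cb)); last first.
    rewrite w0E w1E.
    have -> : r ord0 = - (g a * expR (d ord0) / ca).
      by rewrite /r th0 /ca invrN mulrN opprK (mulrC (g a)).
    have -> : r ord_max = g b * expR (d ord_max) / cb by rewrite /r th1 (mulrC (g b)).
    set x := g a * _ / _ in L0 *; set y := g b * _ / _ in L0 *.
    rewrite -!(mulrA (f a)) -!(mulrA (f b)) -/x -/y.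
    rewrite !opprK (addrC y).
    by field.
  (* The factor [N * expR (- (N * h a))] of both integrals cancels. *)
  apply: cvg_trans lim; apply: near_eq_cvg; exists 1%N => // N /= N1.
  have N0 : N%:R != 0 :> R by rewrite pnatr_eq0 -lt0n.
  have e0 : expR (- (N%:R * h a)) != 0 by rewrite gt_eqF// expR_gt0.
  rewrite /F; under [X in _ / (_ * (_ * X))]eq_Rintegral do rewrite mul1r.
  rewrite mulrA [X in _ / X]mulrA -mulf_div divff ?mul1r//.
  by rewrite mulf_neq0.
move=> flim; apply: cvg_EFin.
  by exists 1%N => // N /= /wl[nuN -> ->].
apply: cvg_trans flim; apply: near_eq_cvg; exists 1%N => // N /= /wl[nuN -> nuNf].
by rewrite nuNf.
Qed.
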